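(* Let $d\ge 1$, $M\in\mathbb{N}$ with $M\ge 2$, $p\in(0,1]$, let $F$ be a fractal percolation on $[0,1]^d$ with parameters $M$ and $p$ and construction steps $F_n$, let $Z^d_n:=M^{(d-D)n}V_d(F_n)$, and let $Z^d_\infty$ denote the almost sure limit of $Z^d_n$ as $n\to\infty$. If $p>M^{-d}$, then $\mathbb{E}Z^d_n=1=\mathbb{E}Z^d_\infty$ for every $n\in\mathbb{N}$ (so $\mathbb{E}Z^d_n\to\mathbb{E}Z^d_\infty$ as $n\to\infty$) and $$\mathrm{Var}(Z^d_\infty)-\mathrm{Var}(Z^d_n)=\frac{1-p}{M^dp-1}\,(M^dp)^{-n}\longrightarrow 0\qquad\text{as } n\to\infty.$$ If $p\le M^{-d}$, then $Z^d_n\to0$ almost surely as $n\to\infty$ (i.e. $Z^d_\infty=0$ almost surely), while $\mathbb{E}Z^d_n=1\to1\neq0=\mathbb{E}Z^d_\infty$ and $\mathrm{Var}(Z^d_n)\to\infty$ as $n\to\infty$.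
   Context: Fractal percolation: Let $J=[0,1]^d$, $\Sigma=\{1,\ldots,M^d\}$, let $J_1,\ldots,J_{M^d}$ be the $M^d$ closed subcubes of side length $1/M$ into which $J$ is divided, and let $\varphi_j$ be the homothetic (rotation- and reflection-free) similarity mapping $J$ onto $J_j$. For $\sigma=\sigma_1\ldots\sigma_n\in\Sigma^n$ let $J_\sigma=\varphi_{\sigma_1}\circ\cdots\circ\varphi_{\sigma_n}(J)$, and for $m\le n$ let $\sigma|m=\sigma_1\ldots\sigma_m$. Let $\{Y_\sigma:\sigma\in\bigcup_{n\ge1}\Sigma^n\}$ be i.i.d. Bernoulli variables with parameter $p$. Put $F_0=J$ and, for $n\ge1$, let $F_n$ be the union of all $J_\sigma$, $\sigma\in\Sigma^n$, with $Y_{\sigma|1}=\cdots=Y_{\sigma|n}=1$. The fractal percolation is $F=\bigcap_n F_n$. $D:=\log(M^dp)/\log M$, so $M^D=M^dp$. $V_d$ is the $d$-dimensional volume. For $p>M^{-d}$ the almost sure limit $Z^d_\infty$ of $Z^d_n$ is known to exist. *)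

(* Defs.v *)
From HB Require Import structures.
From mathcomp Require Import all_boot all_order all_algebra finmap.
From mathcomp Require Import all_classical all_reals all_analysis.
Set Implicit Arguments.
Unset Strict Implicit.
Unset Printing Implicit Defensive.
Import Order.TTheory GRing.Theory Num.Theory.
Import numFieldNormedType.Exports.
Local Open Scope classical_set_scope.
Local Open Scope ring_scope.

(* The library has no Lebesgue measure on R^d.  It is built here on d-tuples,
   with their product sigma-algebra, by iterating the binary product measure;
   R^0 carries the point mass. *)
Fixpoint volume (R : realType) (d : nat) : set (d.-tuple R) -> \bar R :=
  match d with
  | 0 => dirac [tuple]
  | d'.+1 => pushforward (lebesgue_measure \x @volume R d')%E
               (fun x => [tuple of x.1 :: x.2])
  end.
Arguments volume {R d} _.

Section volume_theory.
Context {R : realType}.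

Let tcons d (x : measurableTypeR R * d.-tuple R) : d.+1.-tuple R :=
  [tuple of x.1 :: x.2].

Let measurable_tcons d : measurable_fun [set: _] (@tcons d).
Proof.
by apply: (@measurable_cons _ _ _ (measurableTypeR R) fst d snd);
  [exact: measurable_fst|exact: measurable_snd].
Qed.

Let box d (a b : d.-tuple R) : set (d.-tuple R) :=
  [set x | forall i, tnth a i <= tnth x i <= tnth b i].

Let measurable_box d (a b : d.-tuple R) : measurable (box a b).
Proof.
rewrite (_ : box a b =
    \bigcap_i (@tnth d R ^~ i @^-1` `[tnth a i, tnth b i]%classic)).
  apply: fin_bigcap_measurable => // i _.
  by rewrite -[X in measurable X]setTI; exact: measurable_tnth.
by apply/seteqP; split => x /= h i; [move=> _|have := h i I];
  rewrite /= in_itv//=; exact: h.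
Qed.

Let preimage_box d (a0 b0 : R) (a b : d.-tuple R) :
  @tcons d @^-1` box [tuple of a0 :: a] [tuple of b0 :: b] =
  `[a0, b0] `*` box a b.
Proof.
apply/seteqP; split=> [[x y] h|[x y] [h0 h] i].
  split=> [|i]; first by have := h ord0; rewrite /= in_itv.
  by have := h (lift ord0 i); rewrite !tnthS.
case: (unliftP ord0 i) => [j|] ->; last by move: h0; rewrite /= in_itv.
by rewrite !tnthS; exact: h.
Qed.

Let box_setT d : [set: d.-tuple R] =
  \bigcup_n box [tuple - n%:R | _ < d] [tuple n%:R | _ < d].
Proof.
apply/seteqP; split=> // x _.
exists (Num.truncn (\sum_(i < d) `|tnth x i|)).+1 => // i.
rewrite !tnth_mktuple -ler_norml ltW//.
apply: le_lt_trans (truncnS_gt _).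
by rewrite (bigD1 i)//= lerDl sumr_ge0.
Qed.

Let volume_spec d :
  (exists mu : {sigma_finite_measure set (d.-tuple R) -> \bar R},
     (mu : set _ -> \bar R) = volume) /\
  (forall a b : d.-tuple R, (forall i, tnth a i <= tnth b i) ->
     volume (box a b) = (\prod_(i < d) (tnth b i - tnth a i))%:E).
Proof.
elim: d => [|d [[mu muE] volE]].
  split; first by exists (dirac [tuple]).
  move=> a b _; rewrite big_ord0 /= diracE mem_set//.
  by move=> -[].
have volSE (a b : d.+1.-tuple R) : (forall i, tnth a i <= tnth b i) ->
    volume (box a b) = (\prod_(i < d.+1) (tnth b i - tnth a i))%:E.
  case/tupleP: a => a0 a; case/tupleP: b => b0 b ab.
  rewrite [LHS](congr1 (lebesgue_measure \x volume)%E (preimage_box a0 b0 a b)).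
  rewrite -muE product_measure1E//=; last exact: measurable_box.
  rewrite (lebesgue_measure_itv `[a0, b0]) /= muE volE; last first.
    by move=> i; have := ab (lift ord0 i); rewrite !tnthS.
  rewrite big_ord_recl EFinM lte_fin -EFinB; congr (_ * _)%E.
    have := ab ord0; rewrite /tnth/= => ab0.
    by case: ltgtP ab0 => // -> _; rewrite subrr.
  by congr EFin; apply: eq_bigr => i _; rewrite !tnthS.
split=> //.
pose m := [the {measure set _ -> \bar R} of (lebesgue_measure \x mu)%E].
pose nu : set (d.+1.-tuple R) -> \bar R := pushforward m (@tcons d).
have nuE : nu = volume.
  rewrite /nu -[RHS]/(pushforward (lebesgue_measure \x @volume R d)%E (@tcons d)).
  by rewrite -muE.
have nu0 : nu set0 = 0%E by rewrite /nu /pushforward preimage_set0; exact: measure0.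
have nu_ge0 A : (0 <= nu A)%E by rewrite /nu /pushforward; exact: measure_ge0.
have nu_sigma : semi_sigma_additive nu.
  move=> F mF tF mUF; rewrite /nu /pushforward preimage_bigcup.
  apply: measure_semi_sigma_additive.
  - by move=> n; rewrite -[X in measurable X]setTI; exact: measurable_tcons.
  - apply/trivIsetP => i j _ _ ij; rewrite -preimage_setI.
    by move/trivIsetP : tF => /(_ _ _ _ _ ij) ->//; rewrite preimage_set0.
  - rewrite -preimage_bigcup -[X in measurable X]setTI.
    exact: measurable_tcons.
have nu_sfin : sigma_finite setT nu.
  exists (fun n => box [tuple - n%:R | _ < d.+1] [tuple n%:R | _ < d.+1]).
    exact: box_setT.
  move=> n; split; first exact: measurable_box.
  by rewrite nuE volSE ?ltry// => i; rewrite !tnth_mktuple ge0_cp.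
clearbody nu.
pose nuM := isMeasure.Build _ _ _ nu nu0 nu_ge0 nu_sigma.
pose nu1 : {measure set _ -> \bar R} := HB.pack nu nuM.
pose nuS := @Measure_isSigmaFinite.Build _ _ _ nu1 nu_sfin.
pose nu' : {sigma_finite_measure set _ -> \bar R} := HB.pack nu nuM nuS.
by exists nu'.
Qed.

Let volume0 d : @volume R d set0 = 0%E.
Proof. by have [[mu <-] _] := volume_spec d; exact: measure0. Qed.

Let volume_ge0 d (A : set (d.-tuple R)) : (0 <= volume A)%E.
Proof. by have [[mu <-] _] := volume_spec d; exact: measure_ge0. Qed.

Let volume_semi_sigma_additive d : semi_sigma_additive (@volume R d).
Proof.
by have [[mu <-] _] := volume_spec d; exact: measure_semi_sigma_additive.
Qed.

HB.instance Definition _ d := isMeasure.Build _ _ _ (@volume R d)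
  (volume0 d) (@volume_ge0 d) (@volume_semi_sigma_additive d).

Let volume_sigma_finite d : sigma_finite setT (@volume R d).
Proof. by have [[mu <-] _] := volume_spec d; exact: sigma_finiteT. Qed.

HB.instance Definition _ d := @Measure_isSigmaFinite.Build _ _ _
  (@volume R d) (volume_sigma_finite d).

Lemma volume_box d (a b : d.-tuple R) : (forall i, tnth a i <= tnth b i) ->
  volume [set x : d.-tuple R | forall i, tnth a i <= tnth x i <= tnth b i] =
  (\prod_(i < d) (tnth b i - tnth a i))%:E.
Proof. exact: (volume_spec d).2. Qed.

End volume_theory.

(* The notation is local to its section in the library. *)
Notation "''V_' P [ X ]" := (variance P X) : ereal_scope.

(* Only the X i with i in D are concerned; the X i outside D are arbitrary. *)
Definition mutually_independent (disp disp' : measure_display)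
    (T : measurableType disp) (T' : measurableType disp') (R : realType)
    (P : probability T R) (I : choiceType) (D : set I) (X : I -> T -> T') :=
  forall (A : {fset I}) (B : I -> set T'),
    [set` A] `<=` D -> (forall i, measurable (B i)) ->
    P (\bigcap_(i in [set` A]) (X i @^-1` B i)) =
    (\prod_(i <- A) P (X i @^-1` B i))%E.

Section fractal_percolation.
Context {R : realType} (d M : nat).

(* The alphabet {1, ..., M^d} is rendered as 'I_(M ^ d).  An enumeration
   J_1, ..., J_(M^d) of the subcubes is a bijection c: J_j is the subcube whose
   lowest corner has i-th coordinate (c j i) / M. *)
Variable c : 'I_(M ^ d) -> {ffun 'I_d -> 'I_M}.

Definition unit_cube : set (d.-tuple R) :=
  [set x | forall i, 0 <= tnth x i <= 1].

Definition phi (j : 'I_(M ^ d)) (x : d.-tuple R) : d.-tuple R :=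
  [tuple (tnth x i + (c j i)%:R) / M%:R | i < d].

Definition cube (s : seq 'I_(M ^ d)) : set (d.-tuple R) :=
  (fun x => foldr phi x s) @` unit_cube.

Context {disp : measure_display} {T : measurableType disp}
  {P : probability T R}.

(* The variables Y_s are indexed by the nonempty words s; Y [::] is a dummy,
   which nothing below depends on. *)
Definition iid_bernoulli (p : R) (Y : seq 'I_(M ^ d) -> {RV P >-> bool}) :=
  (forall s, s != [::] -> distribution P (Y s) =1 bernoulli_prob p) /\
  mutually_independent P [set s | s != [::]] Y.

Variable Y : seq 'I_(M ^ d) -> {RV P >-> bool}.

Definition percolation_step (n : nat) (w : T) : set (d.-tuple R) :=
  \bigcup_(s in [set s : seq 'I_(M ^ d) | size s = n /\
                   forall m, (0 < m <= n)%N -> Y (take m s) w]) cube s.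

Definition percolation_dim (p : R) : R :=
  ln (M%:R ^+ d * p) / ln M%:R.

Definition rescaled_volume (p : R) (n : nat) (w : T) : R :=
  M%:R `^ ((d%:R - percolation_dim p) * n%:R) *
  fine (volume (percolation_step n w)).

(* The pointwise limit, with a junk value where the sequence diverges. *)
Definition limit_volume (p : R) (w : T) : R :=
  limn (fun n => rescaled_volume p n w).

End fractal_percolation.

(* Main.v *)
(* The cubes of level n have volume K^-n with K = M^d and overlap only in null
   sets, so Z_n = N_n / m^n with m = K p and N_n the number of surviving words of
   length n, a branching process.

   Averaging over one coordinate Y_a at a time shows that the jumps
   1(parent of u survives) * (Y_u - p), u of length n+1, are centered and
   orthogonal; their sum is N_{n+1} - m N_n. Hence E (Z_{n+1} - Z_n)^2 =
   (1-p)/m * m^-n, and Var Z_n is the sum of the first n such terms.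

   If m > 1, put r = m^(-1/2). The weighted sum S of r^-k (Z_{k+1} - Z_k)^2 is
   integrable. Its finiteness forces the almost sure convergence of Z_n, and by
   Cauchy-Schwarz S / (1 - r) dominates (Z_n - 1)^2, so the means and the
   variances converge by dominated convergence.

   If m <= 1, all the children of at most k survivors die with probability at
   least (1-p)^(K k), independently of the past, while P(N_n > k) <= 1/k. So
   P(N_n > 0) tends to 0. *)
Require Import Defs.
From mathcomp Require Import all_boot all_order all_algebra finmap.
From mathcomp Require Import all_classical all_reals all_analysis.
From mathcomp Require Import measurable_realfun ring lra.
Set Implicit Arguments.
Unset Strict Implicit.
Unset Printing Implicit Defensive.
Import Order.TTheory GRing.Theory Num.Theory.
Import numFieldNormedType.Exports.
Local Open Scope classical_set_scope.
Local Open Scope ring_scope.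

(** * Words and cubes *)

Section words.
Context {I : finType}.
Implicit Types (s t : seq I) (y : seq I -> bool) (n : nat).

(** Survival is a deterministic function of a configuration [y]; randomness enters only later,
    through [config]. The prefixes start at length [1], so [y [::]] is never read. *)
Definition alive s y : bool := all (fun m => y (take m s)) (iota 1 (size s)).

Fixpoint level n : seq (seq I) :=
  if n is n'.+1 then [seq rcons s j | s <- level n', j <- enum I] else [:: [::]].

Lemma mem_level n s : (s \in level n) = (size s == n).
Proof.
elim: n s => [|n IH] s /=; first by rewrite inE; case: s.
apply/allpairsP/eqP => [[[t j] /= [tn _ ->]]|].
  by rewrite size_rcons; move: tn; rewrite IH => /eqP ->.
case: (lastP s) => // t j; rewrite size_rcons => -[tn].
by exists (t, j); split => //=; rewrite ?IH ?tn// mem_enum.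
Qed.

Lemma level_uniq n : uniq (level n).
Proof.
elim: n => //= n IH; apply: allpairs_uniq => //; first exact: enum_uniq.
by move=> [s i] [t j] _ _ /= /rcons_inj[-> ->].
Qed.

Lemma size_level n : size (level n) = (#|I| ^ n)%N.
Proof. by elim: n => //= n IH; rewrite size_allpairs IH -cardE expnSr. Qed.

Lemma alive_rcons s j y : alive (rcons s j) y = alive s y && y (rcons s j).
Proof.
rewrite /alive size_rcons -{1}(addn1 (size s)) iotaD all_cat /= andbT add1n.
rewrite -[(size s).+1](size_rcons s j) take_size; congr (_ && _).
apply: eq_in_all => m; rewrite mem_iota add1n ltnS => /andP[_ ms].
by rewrite -cats1 takel_cat.
Qed.

Lemma aliveP s y :
  reflect (forall m, (0 < m <= size s)%N -> y (take m s)) (alive s y).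
Proof.
apply: (iffP allP) => [h m mn|h m].
  by apply: h; rewrite mem_iota add1n ltnS.
by rewrite mem_iota add1n ltnS; exact: h.
Qed.

End words.
Arguments level : simpl never.

(** * Volumes of unions of cubes of one level *)

Section geometry.
Context {R : realType} (d M : nat).
Hypothesis M0 : (0 < M)%N.
Variable c : 'I_(M ^ d) -> {ffun 'I_d -> 'I_M}.
Hypothesis c_bij : bijective c.

(** The first letter of a word is the outermost map, so the induction prepends a letter: [phi c j]
    maps lowest corner to lowest corner and divides the side by [M]. *)
Lemma cubeE (s : seq 'I_(M ^ d)) : exists a : d.-tuple R, cube c s =
  [set x | forall i, tnth a i <= tnth x i <= tnth a i + M%:R ^- size s].
Proof.
have MR : 0 < M%:R :> R by rewrite ltr0n.
elim: s => [|j s [a IH]].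
  exists [tuple 0 | _ < d].
  rewrite /cube /= image_id; apply/seteqP; split => x /= h i;
    by have := h i; rewrite !tnth_mktuple expr0 invr1 add0r.
exists (phi c j a); rewrite (_ : cube c (j :: s) = phi c j @` cube c s); last first.
  by rewrite /cube image_comp.
rewrite IH; apply/seteqP; split => [_ [x h <-] i|x h] /=.
  have /andP[h1 h2] := h i; rewrite /phi !tnth_mktuple exprS invfM.
  rewrite ler_pM2r ?invr_gt0// lerD2r h1 /= (mulrC M%:R^-1) -mulrDl.
  by rewrite ler_pM2r ?invr_gt0// addrAC lerD2r.
exists [tuple M%:R * tnth x i - (c j i)%:R | i < d] => [i|]; last first.
  apply: eq_from_tnth => i; rewrite !tnth_mktuple subrK mulrAC divff ?mul1r//.
  by rewrite gt_eqF.
have := h i; rewrite /phi !tnth_mktuple exprS invfM => /andP[h1 h2].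
rewrite lerBrDr lerBlDr mulrC -ler_pdivrMr// h1 /=.
rewrite -ler_pdivlMr// (le_trans h2)//.
by rewrite (mulrC M%:R^-1) -mulrDl addrAC.
Qed.

Lemma measurable_cube (s : seq 'I_(M ^ d)) : measurable (cube c s : set (d.-tuple R)).
Proof.
have [a ->] := cubeE s.
rewrite [X in measurable X](_ : _ = \bigcap_i (@tnth d R ^~ i @^-1`
    `[tnth a i, tnth a i + M%:R ^- size s]%classic)).
  apply: fin_bigcap_measurable => // i _.
  by rewrite -[X in measurable X]setTI; exact: measurable_tnth.
by apply/seteqP; split => x /= h i; [move=> _|have := h i I];
  rewrite /= in_itv//=; exact: h.
Qed.

Lemma volume_cube (s : seq 'I_(M ^ d)) :
  volume (cube c s : set (d.-tuple R)) = ((M ^ d)%:R ^- size s)%:E.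
Proof.
have [a ->] := cubeE s.
pose b := [tuple tnth a i + M%:R ^- size s | i < d].
have bE i : tnth b i = tnth a i + M%:R ^- size s by rewrite tnth_mktuple.
rewrite (_ : [set _ | _] =
    [set x : d.-tuple R | forall i, tnth a i <= tnth x i <= tnth b i]).
  rewrite volume_box => [|i]; last by rewrite bE lerDl invr_ge0 exprn_ge0.
  under eq_bigr do rewrite bE addrC addKr.
  by rewrite prodr_const card_ord natrX exprVn -!exprM mulnC.
by apply/seteqP; split => x /= h i; have := h i; rewrite bE.
Qed.

(** The integer parts of [M x] select a subcube containing [x]; blowing it up to the unit cube gives
    a point to which the induction applies. *)
Lemma unit_cube_cover n : @unit_cube R d `<=` \bigcup_(s in [set` level n]) cube c s.
Proof.
have MR : 0 < M%:R :> R by rewrite ltr0n.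
have [c' _ cK] := c_bij.
suff h (x : d.-tuple R) : unit_cube x -> exists2 s, size s = n & cube c s x.
  by move=> x /h[s sn xs]; exists s; rewrite //= mem_level sn.
elim: n x => [|n IH] x xJ.
  by exists [::] => //; exists x.
(* The minimum with [M.-1] treats the coordinate [1], where the integer part of [M x] would be
   [M]. *)
have kM i : (minn M.-1 (Num.truncn (M%:R * tnth x i)) < M)%N.
  by rewrite (leq_ltn_trans (geq_minl _ _))// prednK.
pose k := [ffun i => Ordinal (kM i)].
pose z := [tuple M%:R * tnth x i - (k i)%:R | i < d].
have zJ : unit_cube z.
  move=> i; rewrite tnth_mktuple ffunE/=.
  have /andP[x0 x1] := xJ i.
  have y0 : 0 <= M%:R * tnth x i by rewrite mulr_ge0 // ltW.
  have /andP[t1 t2] := truncn_itv y0.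
  rewrite lerBrDr lerBlDr add0r; apply/andP; split.
    by apply: le_trans t1; rewrite ler_nat geq_minr.
  rewrite addrC natr1; case: leqP => _; last exact: ltW.
  rewrite prednK// -[leRHS]mulr1.
  by rewrite ler_pM2l.
have [s sn [y yJ yz]] := IH _ zJ.
exists (c' k :: s); first by rewrite /= sn.
exists y => //=; rewrite yz; apply: eq_from_tnth => i.
by rewrite !tnth_mktuple cK subrK mulrAC divff ?mul1r// gt_eqF.
Qed.

(** Plain subadditivity: overlaps can only lower the left-hand side. *)
Let volume_bigcup_le n (Q : pred (seq 'I_(M ^ d))) :
  (volume (\bigcup_(s in [set` seq.filter Q (level n)]) cube c s : set (d.-tuple R)) <=
  ((count Q (level n))%:R / (M ^ d)%:R ^+ n)%:E)%E.
Proof.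
rewrite bigcup_seq.
have -> : (count Q (level n))%:R / (M ^ d)%:R ^+ n =
    \sum_(s <- seq.filter Q (level n)) (M ^ d)%:R ^- size s :> R.
  rewrite big_seq; under eq_bigr => s.
    by rewrite mem_filter mem_level => /andP[_ /eqP->]; over.
  by rewrite -big_seq big_const_seq count_predT size_filter iter_addr_0 mulr_natl.
elim: (seq.filter Q (level n)) => [|s l IH].
  by rewrite !big_nil measure0.
rewrite !big_cons EFinD.
apply: le_trans (measureU2 _ _ _) _.
- exact: measurable_cube.
- by apply: bigsetU_measurable => t _; exact: measurable_cube.
- by apply: leeD => //; rewrite [leLHS]volume_cube.
Qed.

(* The upper bound for [predC Q] gives the lower bound for [Q], since all cubes
   of level [n] together cover the unit cube. *)
Lemma volume_bigcup_cube n (Q : pred (seq 'I_(M ^ d))) :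
  volume (\bigcup_(s in [set` seq.filter Q (level n)]) cube c s : set (d.-tuple R)) =
  ((count Q (level n))%:R / (M ^ d)%:R ^+ n)%:E.
Proof.
apply/eqP; rewrite eq_le volume_bigcup_le /=.
pose F (Q : pred (seq 'I_(M ^ d))) : set (d.-tuple R) :=
  \bigcup_(s in [set` seq.filter Q (level n)]) cube c s.
have mF Q' : measurable (F Q').
  by rewrite /F bigcup_seq; apply: bigsetU_measurable => t _; exact: measurable_cube.
have ge1 : (1%E <= volume (F Q) + ((count (predC Q) (level n))%:R / (M ^ d)%:R ^+ n)%:E)%E.
  apply: le_trans (leeD2l _ (volume_bigcup_le n (predC Q))).
  apply: le_trans (measureU2 _ (mF _) (mF _)).
  have -> : 1%E = volume (cube c [::] : set (d.-tuple R)).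
    by rewrite volume_cube expr0 invr1.
  apply: le_measure; rewrite ?inE; [exact: measurable_cube|exact: measurableU|].
  rewrite /cube /= image_id => x /(unit_cube_cover n)[s sn xs].
  by have [Qs|Qs] := boolP (Q s); [left|right]; exists s; rewrite //= mem_filter /= Qs.
(* The counts for [Q] and [predC Q] add up to the number of cubes, so the two upper bounds add up to
   exactly [1]. *)
have /(f_equal (fun k => k%:R : R)) := count_predC Q (level n).
rewrite natrD size_level card_ord natrX => h.
rewrite -(@leeD2rE _ ((count (predC Q) (level n))%:R / (M ^ d)%:R ^+ n)%:E)//.
rewrite -EFinD -mulrDl h divff ?ge1//.
by rewrite expf_neq0// pnatr_eq0 -lt0n expn_gt0 M0.
Qed.

End geometry.

(** * Functions of finitely many Bernoulli variables *)

Section finitely_determined.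
Context {J : choiceType} (D : set J).
Implicit Types (y : J -> bool) (L V : seq J) (U : Type).

Definition determined_by U L (h : (J -> bool) -> U) :=
  forall y y', {in L, y =1 y'} -> h y = h y'.

(** Such functions take finitely many values, so their integrability is automatic, and the class is
    stable under pointwise operations. *)
Definition findet U (h : (J -> bool) -> U) :=
  exists L, [set` L] `<=` D /\ determined_by L h.

(** Conditioning on the coordinate [a] is expressed by composing with [update a true] and
    [update a false]. *)
Definition update (a : J) (b : bool) y : J -> bool :=
  fun i => if i == a then b else y i.

Lemma update_id a y : update a (y a) y = y.
Proof. by apply/funext => i; rewrite /update; case: eqP => // ->. Qed.

Lemma findet_cst U (u : U) : findet (fun=> u).
Proof. by exists [::]; split. Qed.

Lemma findet_coord a : D a -> findet (fun y => y a).
Proof.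
move=> Da; exists [:: a]; split => [i /=|y y' /(_ a)]; first by rewrite inE => /eqP->.
by rewrite inE eqxx => ->.
Qed.

Lemma findet_map2 U1 U2 U3 (f : U1 -> U2 -> U3) h1 h2 :
  findet h1 -> findet h2 -> findet (fun y => f (h1 y) (h2 y)).
Proof.
move=> [L1 [LD1 d1]] [L2 [LD2 d2]]; exists (L1 ++ L2); split => [i /=|y y' yy'].
  by rewrite mem_cat => /orP[/LD1|/LD2].
by congr f; [apply: d1|apply: d2] => i iL; apply: yy'; rewrite mem_cat iL ?orbT.
Qed.

Lemma findet_map U1 U2 (f : U1 -> U2) h : findet h -> findet (fun y => f (h y)).
Proof. by move=> /(findet_map2 (fun x _ => f x)) /(_ (findet_cst tt)). Qed.

Lemma findet_big (U : Type) (idx : U) (op : U -> U -> U) (S : eqType) (l : seq S)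
    (f : S -> (J -> bool) -> U) :
  {in l, forall i, findet (f i)} -> findet (fun y => \big[op/idx]_(i <- l) f i y).
Proof.
elim: l => [_|i l IH fl].
  by under eq_fun do rewrite big_nil; exact: findet_cst.
under eq_fun do rewrite big_cons.
apply: (@findet_map2 _ _ _ op (f i)); first by apply: fl; rewrite mem_head.
by apply: IH => j jl; apply: fl; rewrite inE jl orbT.
Qed.

Lemma determined_by_update U a b L (h : (J -> bool) -> U) :
  determined_by (a :: L) h -> determined_by L (h \o update a b).
Proof.
move=> dh y y' yy'; apply: dh => i; rewrite inE /update.
by case: eqP => //= _; exact: yy'.
Qed.

Lemma findet_update U a b (h : (J -> bool) -> U) :
  findet h -> findet (h \o update a b).
Proof.
move=> [L [LD dh]]; exists L; split=> //; apply: (determined_by_update (a := a)).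
by move=> y y' yy'; apply: dh => i iL; apply: yy'; rewrite inE iL orbT.
Qed.

(** Splitting on the value at [a] leaves two functions of the remaining coordinates. *)
Lemma determined_bounded (R : realDomainType) L (h : (J -> bool) -> R) :
  determined_by L h -> exists C, forall y, `|h y| <= C.
Proof.
elim: L h => [|a L IH] h dh.
  by exists `|h xpred0| => y; rewrite (dh y xpred0).
have [C1 h1] := IH _ (determined_by_update true dh).
have [C0 h0] := IH _ (determined_by_update false dh).
exists (Num.max C1 C0) => y; rewrite le_max -(update_id a y).
by case: (y a); rewrite ?h1 ?h0 ?orbT.
Qed.

End finitely_determined.

(** * Expectations of functions of independent Bernoulli variables *)

Section bernoulli_field.
Context {J : choiceType} (D : set J) {disp : measure_display}
  {T : measurableType disp} {R : realType} {P : probability T R} (p : R).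
Hypothesis p01 : 0 <= p <= 1.
Variable Y : J -> {RV P >-> bool}.
Hypothesis YD : forall s, D s -> distribution P (Y s) =1 bernoulli_prob p.
Hypothesis Yind : mutually_independent P D Y.
Implicit Types (h : (J -> bool) -> R) (L V : seq J).

Definition config (w : T) : J -> bool := fun i => Y i w.

Definition esp h : R := \int[P]_w h (config w).

(** The splitting on [y a] turns [h \o config] into a case distinction on the measurable [Y a]. *)
Lemma determined_measurable L h :
  determined_by L h -> measurable_fun setT (h \o config).
Proof.
elim: L h => [|a L IH] h dh.
  rewrite (_ : _ \o _ = cst (h xpred0)); first exact: measurable_cst.
  by apply/funext => w /=; exact: dh.
rewrite (_ : _ \o _ = fun w => if Y a w then h (update a true (config w))
                               else h (update a false (config w))).
  apply: measurable_fun_ifT => //.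
  - exact: IH (determined_by_update true dh).
  - exact: IH (determined_by_update false dh).
apply/funext => w /=; rewrite -[in LHS](update_id a (config w)) {1}/config.
by case: (Y a w).
Qed.

Lemma findet_measurable h : findet D h -> measurable_fun setT (h \o config).
Proof. by move=> [L [_ /determined_measurable]]. Qed.

Lemma findet_integrable h : findet D h -> P.-integrable setT (EFin \o (h \o config)).
Proof.
move=> hf; have [L [_ /determined_bounded[C hC]]] := hf.
apply: measurable_bounded_integrable => //.
- by rewrite [X in (X < _)%E]probability_setT ltry.
- exact: findet_measurable.
exists C; split; first exact: num_real.
by move=> x Cx w _; exact: le_trans (hC _) (ltW Cx).
Qed.

Lemma EFin_esp h : findet D h -> (\int[P]_w (h (config w))%:E)%E = (esp h)%:E.
Proof.
by move=> hf; rewrite /esp fineK//; apply: integrable_fin_num => //; exact: findet_integrable.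
Qed.

Lemma esp_cst (k : R) : esp (fun=> k) = k.
Proof. by rewrite /esp Rintegral_cst// [X in fine X]probability_setT mulr1. Qed.

Lemma espD h1 h2 : findet D h1 -> findet D h2 ->
  esp (fun y => h1 y + h2 y) = esp h1 + esp h2.
Proof. by move=> f1 f2; rewrite /esp RintegralD//; exact: findet_integrable. Qed.

Lemma espB h1 h2 : findet D h1 -> findet D h2 ->
  esp (fun y => h1 y - h2 y) = esp h1 - esp h2.
Proof. by move=> f1 f2; rewrite /esp RintegralB//; exact: findet_integrable. Qed.

Lemma espZ k h : findet D h -> esp (fun y => k * h y) = k * esp h.
Proof. by move=> f; rewrite /esp RintegralZl//; exact: findet_integrable. Qed.

Lemma esp_sum (S : eqType) (l : seq S) (f : S -> (J -> bool) -> R) :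
  {in l, forall i, findet D (f i)} ->
  esp (fun y => \sum_(i <- l) f i y) = \sum_(i <- l) esp (f i).
Proof.
elim: l => [_|i l IH fl].
  by under eq_fun do rewrite big_nil; rewrite big_nil esp_cst.
under eq_fun do rewrite big_cons.
have fl' : {in l, forall i, findet D (f i)}.
  by move=> j jl; apply: fl; rewrite inE jl orbT.
rewrite espD ?IH ?big_cons//; first by apply: fl; rewrite mem_head.
exact: findet_big.
Qed.

Lemma le_esp h1 h2 : findet D h1 -> findet D h2 ->
  (forall y, h1 y <= h2 y) -> esp h1 <= esp h2.
Proof. by move=> f1 f2 h12; apply: le_Rintegral => //; exact: findet_integrable. Qed.

Let bp (b : bool) : R := if b then p else 1 - p.

Let marginal a b : D a -> P (Y a @^-1` [set b]) = (bp b)%:E.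
Proof.
move=> Da; rewrite -[LHS]/(distribution P (Y a) [set b]) YD//.
rewrite /bernoulli_prob p01 fsbig_set1.
by case: b.
Qed.

(** The indicator of a cylinder, written as a product so that one coordinate can be split off. *)
Let cyl V (e : J -> bool) y : R := \prod_(v <- V) (y v == e v)%:R.

(** Mutual independence enters the whole argument through this formula. *)
Let esp_cyl V e : uniq V -> [set` V] `<=` D -> esp (cyl V e) = \prod_(v <- V) bp (e v).
Proof.
move=> uV VD.
(* Independence is phrased for finite sets, hence the passage from the duplicate-free list [V] to a
   set. *)
have pV : perm_eq [fset v in V]%fset V.
  by apply: uniq_perm => // v; rewrite in_fset.
have := Yind (A := [fset v in V]%fset) (B := fun v => [set e v]).
rewrite (_ : [set` [fset v in V]%fset] = [set` V]); last first.
  by apply/seteqP; split => v /=; rewrite in_fset.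
move=> /(_ VD (fun=> I)).
rewrite (perm_big _ pV)/= big_seq.
under eq_bigr => v vV do rewrite (marginal _ (VD _ vV)).
rewrite -big_seq prodEFin => PV.
suff : (esp (cyl V e))%:E = (\prod_(v <- V) bp (e v))%:E by case.
rewrite -PV.
have mC : measurable (\bigcap_(v in [set` V]) (Y v @^-1` [set e v])).
  rewrite bigcap_seq; apply: bigsetI_measurable => v _.
  by rewrite -[X in measurable X]setTI; exact: measurable_funP.
have cE w : cyl V e (config w) = \1_(\bigcap_(v in [set` V]) (Y v @^-1` [set e v])) w.
  rewrite indicE /cyl; have [h|h] := pselect (forall v, v \in V -> Y v w = e v).
    rewrite mem_set ?big_seq ?big1// => v vV.
    by rewrite /config h ?eqxx.
  rewrite memNset; last by move=> h'; apply: h => v vV; exact: h'.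
  move: h => /existsNP[v /not_implyP[vV /eqP Yv]].
  by rewrite (big_rem v)//= /config (negPf Yv) mul0r.
rewrite /esp; under eq_Rintegral do rewrite cE.
rewrite /Rintegral integral_indic// setIT fineK//.
exact: fin_num_measure.
Qed.

Let findet_cyl V e : [set` V] `<=` D -> findet D (cyl V e).
Proof.
move=> VD; exists V; split => // y y' yy'.
by rewrite /cyl big_seq [RHS]big_seq; apply: eq_bigr => v vV; rewrite yy'.
Qed.

(* [r] does not depend on the cylinder: the coordinates in [L] are independent
   of the others. *)
Let esp_block L h : uniq L -> [set` L] `<=` D -> determined_by L h ->
  exists r, forall V e, uniq V -> [set` V] `<=` D -> {in L, forall i, i \notin V} ->
  esp (fun y => h y * cyl V e y) = r * \prod_(v <- V) bp (e v).
Proof.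
elim: L h => [|a L IH] h uL LD dh.
  exists (h xpred0) => V e uV VD _; rewrite -esp_cyl// -espZ//; last exact: findet_cyl.
  by congr esp; apply/funext => y; rewrite (dh y xpred0).
have [aL {}uL] : a \notin L /\ uniq L by apply/andP.
have Da : D a by apply: LD; rewrite /= mem_head.
have LD' : [set` L] `<=` D by move=> i iL; apply: LD; rewrite /= inE; apply/orP; right.
have dL b := determined_by_update b dh.
have [r1 h1] := IH _ uL LD' (dL true); have [r0 h0] := IH _ uL LD' (dL false).
(* The two values of [Y a] are weighted by [p] and [1 - p]; in each case [a] moves from the block
   into the cylinder. *)
exists (p * r1 + (1 - p) * r0) => V e uV VD LV.
have aV : a \notin V by apply: LV; rewrite mem_head.
have uaV : uniq (a :: V) by rewrite /= aV.
have aVD : [set` (a :: V)] `<=` D by move=> i /=; rewrite inE => /predU1P[->//|/VD].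
have LaV : {in L, forall i, i \notin a :: V}.
  move=> i iL; rewrite inE negb_or LV ?inE ?iL ?orbT// andbT.
  by apply: contraNneq aL => <-.
have cylE b y : cyl (a :: V) (update a b e) y = (y a == b)%:R * cyl V e y.
  rewrite /cyl big_cons {1}/update eqxx big_seq [in RHS]big_seq; congr (_ * _).
  by apply: eq_bigr => v vV; rewrite /update; case: (v =P a) => // va; rewrite -va vV in aV.
have bpE b : \prod_(v <- a :: V) bp (update a b e v) = bp b * \prod_(v <- V) bp (e v).
  rewrite big_cons {1}/update eqxx big_seq [in RHS]big_seq; congr (_ * _).
  by apply: eq_bigr => v vV; rewrite /update; case: (v =P a) => // va; rewrite -va vV in aV.
have fd b : findet D (fun y => (h \o update a b) y * cyl (a :: V) (update a b e) y).
  apply: findet_map2; last exact: findet_cyl.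
  by exists L.
rewrite (_ : (fun y => _) = fun y =>
    (h \o update a true) y * cyl (a :: V) (update a true e) y +
    (h \o update a false) y * cyl (a :: V) (update a false e) y); last first.
  apply/funext => y; rewrite !cylE /= -[in h y](update_id a y).
  by case: (y a); rewrite /= !(mul0r,mulr0,mul1r,addr0,add0r).
rewrite espD; [|exact: fd|exact: fd].
rewrite h1// h0// !bpE /=; ring.
Qed.

(** The law of total expectation over [Y a]: once [a] is fixed, the updated functions no longer read
    it, and [esp_block] separates them from the event [Y a = b]. *)
Lemma esp_average h a : D a -> findet D h ->
  esp h = p * esp (h \o update a true) + (1 - p) * esp (h \o update a false).
Proof.
move=> Da [L [LD dh]].
(* Removing [a] from the coordinates makes the cylinder over [a] disjoint from the block. *)
pose L' := [seq i <- undup L | i != a].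
have uL' : uniq L' by rewrite filter_uniq// undup_uniq.
have LD' : [set` L'] `<=` D.
  by move=> i /=; rewrite mem_filter mem_undup => /andP[_ /LD].
have dL' : determined_by (a :: L') h.
  move=> y y' yy'; apply: dh => i iL; apply: yy'.
  by rewrite inE mem_filter mem_undup iL andbT; case: eqP.
have aD : [set` [:: a]] `<=` D by move=> i /=; rewrite inE => /eqP->.
have aL' : {in L', forall i, i \notin [:: a]}.
  by move=> i; rewrite mem_filter inE => /andP[].
have key b : esp (fun y => (h \o update a b) y * cyl [:: a] (fun=> b) y) =
    bp b * esp (h \o update a b).
  have [r hr] := esp_block uL' LD' (determined_by_update b dL').
  rewrite hr// big_seq1 mulrC; congr (_ * _).
  (* The empty cylinder identifies the constant [r] as the expectation itself. *)
  have := hr [::] (fun=> b); rewrite big_nil mulr1 => <-//.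
  by congr esp; apply/funext => y; rewrite /cyl big_nil mulr1.
have fd b : findet D (fun y => (h \o update a b) y * cyl [:: a] (fun=> b) y).
  apply: findet_map2; last exact: findet_cyl.
  by apply: findet_update; exists L.
rewrite -(key true) -(key false) -espD//; congr esp; apply/funext => y.
rewrite /cyl !big_seq1 /= -[in h y](update_id a y).
by case: (y a); rewrite /= !(mul0r,mulr0,mulr1,addr0,add0r).
Qed.

(** Averaging over [a] leaves the factor [p (1 - p) + (1 - p) (0 - p) = 0]. *)
Lemma esp_centered g a : D a -> findet D g -> (forall b y, g (update a b y) = g y) ->
  esp (fun y => g y * ((y a)%:R - p)) = 0.
Proof.
move=> Da fg ga.
have fd : findet D (fun y => g y * ((y a)%:R - p)).
  by apply: findet_map2 => //; apply: (findet_map (fun b : bool => b%:R - p)); exact: findet_coord.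
rewrite (esp_average Da fd).
have E b : esp ((fun y => g y * ((y a)%:R - p)) \o update a b) = (b%:R - p) * esp g.
  rewrite -espZ//; congr esp; apply/funext => y /=.
  by rewrite ga {1}/update eqxx mulrC.
by rewrite !E /=; ring.
Qed.

(** The same averaging now produces the Bernoulli variance [p (1 - p)]. *)
Lemma esp_centered_sqr g a : D a -> findet D g ->
  (forall b y, g (update a b y) = g y) ->
  esp (fun y => g y * ((y a)%:R - p) ^+ 2) = p * (1 - p) * esp g.
Proof.
move=> Da fg ga.
have fd : findet D (fun y => g y * ((y a)%:R - p) ^+ 2).
  by apply: findet_map2 => //; apply: (findet_map (fun b : bool => (b%:R - p) ^+ 2));
    exact: findet_coord.
rewrite (esp_average Da fd).
have E b : esp ((fun y => g y * ((y a)%:R - p) ^+ 2) \o update a b) = (b%:R - p) ^+ 2 * esp g.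
  rewrite -espZ//; congr esp; apply/funext => y /=.
  by rewrite ga {1}/update eqxx mulrC.
by rewrite !E /=; ring.
Qed.

End bernoulli_field.

(** * The number of surviving words *)

Section branching_process.
Context {I : finType} {disp : measure_display} {T : measurableType disp}
  {R : realType} {P : probability T R} (p : R).
Let D : set (seq I) := [set s | s != [::]].
Hypothesis p0 : 0 < p.
Hypothesis p1 : p <= 1.
Hypothesis I0 : (0 < #|I|)%N.
Variable Y : seq I -> {RV P >-> bool}.
Hypothesis YD : forall s, D s -> distribution P (Y s) =1 bernoulli_prob p.
Hypothesis Yind : mutually_independent P D Y.
Implicit Types (y : seq I -> bool) (s u : seq I) (n k : nat).

Local Notation K := (#|I|).
Local Notation m := (#|I|%:R * p).
Local Notation esp := (esp Y).

Let p01 : 0 <= p <= 1. Proof. by rewrite p1 ltW. Qed.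

Let m0 : 0 < m. Proof. by rewrite mulr_gt0// ltr0n. Qed.

Definition survivors n y := count (alive^~ y) (level n).

Lemma findet_alive s : findet D (alive s).
Proof.
elim/last_ind: s => [|s j IH]; first exact: findet_cst.
rewrite (_ : alive _ = fun y => alive s y && y (rcons s j)); last first.
  by apply/funext => y; exact: alive_rcons.
by apply: findet_map2 => //; apply: findet_coord; rewrite /D/= -size_eq0 size_rcons.
Qed.

Lemma alive_update s u b y : (size s < size u)%N -> alive s (update u b y) = alive s y.
Proof.
move=> su; apply: eq_all => i; rewrite /update; case: eqP => // iu.
by move: su; rewrite -iu ltnNge size_take_min geq_minr.
Qed.

Lemma survivors_update n u b y : (n < size u)%N ->
  survivors n (update u b y) = survivors n y.
Proof.
move=> nu; apply: eq_in_count => s; rewrite mem_level => /eqP sn.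
by rewrite alive_update// sn.
Qed.

Lemma survivorsE n y : (survivors n y)%:R = \sum_(s <- level n) (alive s y)%:R :> R.
Proof. by rewrite /survivors -sum1_count big_mkcond natr_sum; apply: eq_bigr => s _; case: ifP. Qed.

Lemma findet_survivors n : findet D (survivors n).
Proof.
rewrite (_ : survivors n = fun y => (\sum_(s <- level n) alive s y)%N).
  by apply: findet_big => s _; apply: (findet_map (fun b : bool => b : nat)); exact: findet_alive.
by apply/funext => y; rewrite /survivors -sum1_count big_mkcond; apply: eq_bigr => s _; case: ifP.
Qed.

Let findetN n : findet D (fun y => (survivors n y)%:R : R).
Proof. exact: (findet_map (fun k => k%:R : R) (findet_survivors n)). Qed.

(** Groups the words of length [n + 1] by their parent [take n u]. *)
Lemma big_level_recr (S : Type) (idx : S) (op : Monoid.com_law idx) n (f : seq I -> seq I -> S) :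
  \big[op/idx]_(u <- level n.+1) f (take n u) u =
  \big[op/idx]_(s <- level n) \big[op/idx]_(j : I) f s (rcons s j).
Proof.
rewrite big_allpairs_dep big_seq [RHS]big_seq.
apply: eq_bigr => s; rewrite mem_level => /eqP sn.
rewrite big_enum/=; apply: eq_bigr => j _.
by rewrite -sn -cats1 take_size_cat.
Qed.

Lemma aliveS n u y : size u = n.+1 -> alive u y = alive (take n u) y && y u.
Proof.
case: (lastP u) => // s j; rewrite size_rcons => -[<-].
by rewrite alive_rcons -[in take _ _]cats1 take_size_cat.
Qed.

(** A martingale difference: the survival of the parent reads only words shorter than [u]. *)
Let jump n u y : R := (alive (take n u) y)%:R * ((y u)%:R - p).

Let findet_jump n u : u \in level n.+1 -> findet D (jump n u).
Proof.
rewrite mem_level => /eqP un.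
apply: (findet_map2 (fun a b : bool => a%:R * (b%:R - p))); first exact: findet_alive.
by apply: findet_coord; rewrite /D/= -size_eq0 un.
Qed.

Let level_size k u : u \in level k -> size u = k.
Proof. by rewrite mem_level => /eqP. Qed.

Let level_neq0 n u : u \in level n.+1 -> D u.
Proof. by rewrite mem_level /D/= -size_eq0 => /eqP ->. Qed.

Let sum_jump n y :
  \sum_(u <- level n.+1) jump n u y = (survivors n.+1 y)%:R - m * (survivors n y)%:R.
Proof.
under eq_bigr do rewrite /jump mulrBr.
rewrite sumrB !survivorsE; congr (_ - _).
  rewrite big_seq [RHS]big_seq; apply: eq_bigr => u; rewrite mem_level => /eqP un.
  by rewrite (aliveS _ un) -natrM mulnb.
rewrite (big_level_recr _ n (fun s _ => (alive s y)%:R * p)) /=.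
rewrite mulr_sumr; apply: eq_bigr => s _.
by rewrite sumr_const -[LHS]mulr_natl mulrA mulrAC.
Qed.

Let esp_mul_jump n u g : u \in level n.+1 -> findet D g ->
  (forall b y, g (update u b y) = g y) -> esp (fun y => g y * jump n u y) = 0.
Proof.
move=> un fg gu.
under [X in esp X]eq_fun do rewrite /jump mulrA.
apply: (esp_centered p01 YD Yind (level_neq0 un)
    (g := fun y => g y * (alive (take n u) y)%:R)).
  apply: findet_map2 => //.
  by apply: (findet_map (fun b : bool => b%:R)); exact: findet_alive.
move=> b y; rewrite gu alive_update// size_take_min (leq_ltn_trans (geq_minl _ _))//.
by move: un; rewrite mem_level => /eqP ->.
Qed.

(** The martingale property in weak form: [g] stands for any function of the past of level
    [n + 1]. *)
Let esp_mul_sum_jump n g : findet D g ->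
  (forall u b y, u \in level n.+1 -> g (update u b y) = g y) ->
  esp (fun y => g y * \sum_(u <- level n.+1) jump n u y) = 0.
Proof.
move=> fg gu; under [X in esp X]eq_fun do rewrite mulr_sumr.
rewrite (esp_sum (D := D)) => [|u un]; last by apply: findet_map2 => //; exact: findet_jump.
by rewrite big_seq big1// => u un; rewrite esp_mul_jump// => b y; exact: gu.
Qed.

(** With [g = 1], the orthogonality above reads [E N_{n+1} = m E N_n]. *)
Lemma esp_survivors n : esp (fun y => (survivors n y)%:R) = m ^+ n.
Proof.
elim: n => [|n IH].
  by under [X in esp X]eq_fun do rewrite /survivors /level /=; rewrite esp_cst.
have := @esp_mul_sum_jump n (fun=> 1) (findet_cst _ _) (fun _ _ _ _ => erefl).
under [X in esp X]eq_fun do rewrite mul1r sum_jump.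
rewrite (espB (D := D)) ?(espZ (D := D)) ?IH -?exprS//;
  last by apply: (findet_map (fun x => m * x)).
by move/eqP; rewrite subr_eq0 => /eqP.
Qed.

(** Off-diagonal products vanish, because [jump n u] does not read another word [v] of the same
    level. The diagonal gives [p (1 - p)] for each of the [K] children of a survivor, in total
    [p (1 - p) K m^n]. *)
Let esp_sum_jump_sqr n :
  esp (fun y => (\sum_(u <- level n.+1) jump n u y) ^+ 2) = (1 - p) * m ^+ n.+1.
Proof.
under [X in esp X]eq_fun do rewrite expr2 big_distrlr /=.
have fjj u v : u \in level n.+1 -> v \in level n.+1 ->
    findet D (fun y => jump n u y * jump n v y).
  by move=> un vn; apply: findet_map2; exact: findet_jump.
rewrite (esp_sum (D := D)) => [|u un]; last first.
  by apply: findet_big => v vn; exact: fjj.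
have sz u : u \in level n.+1 -> (size (take n u) < n.+1)%N.
  by move=> _; rewrite size_take_min ltnS geq_minl.
transitivity (\sum_(u <- level n.+1) p * (1 - p) * esp (fun y => (alive (take n u) y)%:R)).
  rewrite big_seq [RHS]big_seq; apply: eq_bigr => u un.
  rewrite (esp_sum (D := D)) => [|v vn]; last exact: fjj.
  rewrite (bigD1_seq u un (level_uniq n.+1)) big_seq_cond big1 => [|v /andP[vn vu]].
    rewrite -(esp_centered_sqr p01 YD Yind (level_neq0 un)).
    - rewrite [LHS]addr0; congr (esp _); apply/funext => y; rewrite /jump.
      by case: (alive _ _); rewrite /= ?(mul0r,mul1r,expr2).
    - by apply: (findet_map (fun b : bool => b%:R)); exact: findet_alive.
    - by move=> b y; rewrite alive_update// (level_size un) sz.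
  apply: esp_mul_jump => // [|b y]; first exact: findet_jump.
  rewrite /jump alive_update ?[in update _ _ _ u]/update.
    by rewrite eq_sym (negPf vu).
  by rewrite (level_size vn) sz.
rewrite -mulr_sumr (big_level_recr _ n (fun s _ => esp (fun y => (alive s y)%:R))) /=.
rewrite [X in _ * X](_ : _ = K%:R * m ^+ n); first by rewrite exprS; ring.
rewrite -esp_survivors; under [X in _ = _ * esp X]eq_fun do rewrite survivorsE.
rewrite (esp_sum (D := D)) => [|s _]; last first.
  by apply: (findet_map (fun b : bool => b%:R)); exact: findet_alive.
by rewrite mulr_sumr; apply: eq_bigr => s _; rewrite sumr_const mulr_natl.
Qed.

(** The normalised population, which [rescaled_volumeE] identifies with the rescaled volume. *)
Definition martingale n y : R := (survivors n y)%:R / m ^+ n.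

Local Notation Z := martingale.

Lemma findet_martingale n : findet D (Z n).
Proof. exact: (findet_map (fun x => x / m ^+ n) (findetN n)). Qed.

Lemma esp_martingale n : esp (Z n) = 1.
Proof.
rewrite /martingale; under [X in esp X]eq_fun do rewrite mulrC.
by rewrite (espZ (D := D))// esp_survivors mulVf// expf_neq0// gt_eqF.
Qed.

Lemma martingale_increment n y :
  Z n.+1 y - Z n y = m ^- n.+1 * \sum_(u <- level n.+1) jump n u y.
Proof.
rewrite sum_jump /martingale mulrBr mulrC; congr (_ - _).
rewrite exprS invfM [in RHS]mulrC mulrA; congr (_ * _).
by rewrite [X in _ = X / _]mulrC mulfK// gt_eqF.
Qed.

Lemma esp_increment_sqr n :
  esp (fun y => (Z n.+1 y - Z n y) ^+ 2) = (1 - p) / m * m ^- n.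
Proof.
under [X in esp X]eq_fun do rewrite martingale_increment exprMn.
rewrite (espZ (D := D)) ?esp_sum_jump_sqr.
  rewrite !exprS expr0 mulr1; set q := m ^+ n.
  have q0 : q != 0 by rewrite expf_neq0// gt_eqF.
  by field; rewrite q0 gt_eqF// pnatr_eq0 -lt0n I0.
apply: (findet_map (fun x => x ^+ 2)).
by apply: findet_big => u un; exact: findet_jump.
Qed.

(** Each increment is orthogonal to the past, so the second moments of the increments add up. *)
Lemma esp_martingale_var n :
  esp (fun y => (Z n y - 1) ^+ 2) = (1 - p) / m * \sum_(k < n) m ^- k.
Proof.
elim: n => [|n IH].
  under [X in esp X]eq_fun do
    rewrite /martingale /survivors /level /= expr0 divr1 subrr expr0n.
  by rewrite big_ord0 mulr0 esp_cst.
have f1 k : findet D (fun y => Z k y - 1).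
  exact: (findet_map (fun x => x - 1) (findet_martingale k)).
have fi : findet D (fun y => Z n.+1 y - Z n y).
  by apply: (findet_map2 (fun a b => a - b)); exact: findet_martingale.
(* The cross term keeps the sum of jumps explicit, so that [esp_mul_sum_jump] cancels it. *)
rewrite (_ : (fun y => _) = fun y => (Z n y - 1) ^+ 2 + (2 * m ^- n.+1 *
    ((Z n y - 1) * \sum_(u <- level n.+1) jump n u y) + (Z n.+1 y - Z n y) ^+ 2)); last first.
  apply/funext => y; rewrite -mulrA [X in 2 * X]mulrCA -martingale_increment.
  by ring.
have fsq g : findet D g -> findet D (fun y => g y ^+ 2 : R).
  exact: (findet_map (fun x : R => x ^+ 2)).
have fj : findet D (fun y => \sum_(u <- level n.+1) jump n u y).
  by apply: findet_big => u un; exact: findet_jump.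
have fm : findet D (fun y => (Z n y - 1) * \sum_(u <- level n.+1) jump n u y).
  exact: findet_map2.
rewrite (espD (D := D)); [|exact: fsq|]; last first.
  apply: findet_map2; last exact: fsq.
  exact: (findet_map (fun x : R => 2 * m ^- n.+1 * x)).
rewrite (espD (D := D)); [|exact: (findet_map (fun x : R => 2 * m ^- n.+1 * x))|exact: fsq].
rewrite (espZ (D := D))// esp_mul_sum_jump//; last first.
  by move=> u b y; rewrite mem_level /martingale => /eqP un; rewrite survivors_update ?un.
by rewrite mulr0 add0r esp_increment_sqr IH big_ord_recr/= mulrDr.
Qed.

(** The words of [l] are averaged out one at a time: no other factor reads [u], and averaging
    [alive u] over [Y u] gives [p] times the survival of its parent. *)
Let esp_prod_extinct n l g : uniq l -> {subset l <= level n.+1} -> findet D g ->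
  (forall u b y, u \in l -> g (update u b y) = g y) ->
  esp (fun y => g y * \prod_(u <- l) (1 - (alive u y)%:R)) =
  esp (fun y => g y * \prod_(u <- l) (1 - p * (alive (take n u) y)%:R)).
Proof.
elim: l g => [|u l IH] g; first by move=> *; congr (esp _); apply/funext => y; rewrite !big_nil.
move=> /= /andP[ul uql] lS fg gu.
have un : u \in level n.+1 by apply: lS; rewrite mem_head.
have szu : size u = n.+1 by apply/eqP; rewrite -mem_level.
have fa s : findet D (fun y => (alive s y)%:R : R).
  by apply: (findet_map (fun b : bool => b%:R)); exact: findet_alive.
have lS' : {subset l <= level n.+1} by move=> v vl; apply: lS; rewrite inE vl orbT.
have szl v : v \in l -> size v = n.+1 by move=> /lS'; rewrite mem_level => /eqP.
(* The factor of [u] is absorbed into [g] while the rest of the list is averaged. *)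
pose g1 y := g y * (1 - (alive u y)%:R).
transitivity (esp (fun y => g1 y * \prod_(v <- l) (1 - (alive v y)%:R))).
  by congr (esp _); apply/funext => y; rewrite big_cons mulrA.
rewrite (IH g1)//; last 2 first.
- by apply: findet_map2 => //; exact: (findet_map (fun x => 1 - x)).
- move=> v b y vl; rewrite /g1 gu ?inE ?vl ?orbT//; congr (_ * (1 - _%:R)).
  rewrite !(aliveS _ szu) alive_update ?[in update _ _ _ u]/update; last first.
    by rewrite (szl v vl) size_take_min ltnS geq_minl.
  by case: (u =P v) => // uv; move: ul; rewrite uv vl.
pose g' y := g y * \prod_(v <- l) (1 - p * (alive (take n v) y)%:R).
have fg' : findet D g'.
  apply: findet_map2 => //; apply: findet_big => v _.
  exact: (findet_map (fun x => 1 - p * x)).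
have inv u' b y : size u' = n.+1 ->
    \prod_(v <- l) (1 - p * (alive (take n v) (update u' b y))%:R) =
    \prod_(v <- l) (1 - p * (alive (take n v) y)%:R).
  move=> szu'; apply: eq_bigr => v _; rewrite alive_update// szu'.
  by rewrite size_take_min ltnS geq_minl.
(* The factor [1 - alive u] differs from its average by exactly [jump n u], which has mean zero
   against [g']. *)
rewrite (_ : (fun y => _) = fun y => g' y * (1 - p * (alive (take n u) y)%:R)
    - g' y * jump n u y); last first.
  apply/funext => y; rewrite /g1 /g' /jump (aliveS _ szu) -mulnb natrM.
  by set X := \prod_(_ <- _) _; ring.
rewrite (espB (D := D)); last 2 first.
- by apply: findet_map2 => //; exact: (findet_map (fun x => 1 - p * x)).
- by apply: findet_map2 => //; exact: findet_jump.
rewrite esp_mul_jump// ?subr0 => [|b y]; last first.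
  by rewrite /g' gu ?mem_head// inv.
by congr (esp _); apply/funext => y; rewrite /g' big_cons mulrA mulrAC.
Qed.

(** Given the first [n] levels, the [K N_n] children of survivors all die with probability
    [(1 - p)^(K N_n)]. *)
Lemma esp_extinct n g : findet D g ->
  (forall u b y, size u = n.+1 -> g (update u b y) = g y) ->
  esp (fun y => g y * (survivors n.+1 y == 0)%:R) =
  esp (fun y => g y * (1 - p) ^+ (K * survivors n y)).
Proof.
move=> fg gu.
(* For [q = 1] this is the indicator of extinction, as [0 ^+ k] is [1] only at [k = 0]; for [q = p]
   it evaluates the averaged product. *)
have prodE (f : seq I -> bool) (q : R) (l : seq (seq I)) :
    \prod_(u <- l) (1 - q * (f u)%:R) = (1 - q) ^+ count f l.
  elim: l => [|u l IH]; first by rewrite big_nil expr0.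
  by rewrite big_cons IH /= exprD; case: (f u); rewrite ?(mulr1,mulr0,subr0,expr0,expr1).
transitivity (esp (fun y => g y * \prod_(u <- level n.+1) (1 - (alive u y)%:R))).
  congr (esp _); apply/funext => y; congr (_ * _).
  under eq_bigr do rewrite -[X in 1 - X]mul1r.
  by rewrite prodE subrr expr0n.
rewrite (@esp_prod_extinct n)//; [|exact: level_uniq|]; last first.
  by move=> u b y; rewrite mem_level => /eqP un; exact: gu.
congr (esp _); apply/funext => y; congr (_ * _).
rewrite (big_level_recr _ n (fun s _ => 1 - p * (alive s y)%:R)) /=.
under eq_bigr do rewrite prodr_const.
by rewrite prodrXl prodE -exprM mulnC.
Qed.

Lemma survivors_eq0S n y : survivors n y = 0 -> survivors n.+1 y = 0.
Proof.
move=> /eqP; rewrite /survivors -leqn0 leqNgt -has_count => /hasPn h.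
apply/eqP; rewrite -leqn0 leqNgt -has_count; apply/hasPn => u un.
rewrite (aliveS _ (n := n)); last by apply/eqP; rewrite -mem_level.
rewrite negb_and h// mem_level size_takel//.
by move: un; rewrite mem_level => /eqP ->.
Qed.

Definition survival_prob n : R := esp (fun y => (0 < survivors n y)%N%:R).

Lemma survival_probS_le n k : (0 < k)%N -> m <= 1 ->
  (1 - p) ^+ (K * k) * (survival_prob n - k%:R^-1) <=
  survival_prob n - survival_prob n.+1.
Proof.
move=> k0 m1.
have k0' : 0 < k%:R :> R by rewrite ltr0n.
have fs (f : nat -> R) i : findet D (fun y => f (survivors i y)).
  exact: findet_map (findet_survivors i).
(* The indicator of [0 < N_n <= k], from which extinction in one step has a probability bounded
   below. *)
pose g (c : nat) : R := ((0 < c) && (c <= k))%N%:R.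
have q0 : 0 <= 1 - p by rewrite subr_ge0.
apply: (@le_trans _ _ ((1 - p) ^+ (K * k) * esp (fun y => g (survivors n y)))).
  rewrite ler_wpM2l ?exprn_ge0// lerBlDr.
  have -> : k%:R^-1 = esp (fun=> k%:R^-1 : R) by rewrite esp_cst.
  (* Markov's inequality: where [N_n > k], the indicator of survival is at most [N_n / k], and
     [E N_n = m^n <= 1]. *)
  apply: (@le_trans _ _ (esp (fun y => g (survivors n y) + k%:R^-1 * (survivors n y)%:R))).
    apply: (le_esp (D := D)) => [||y]; [exact: (fs (fun c => (0 < c)%N%:R))| |].
      exact: (fs (fun c => g c + k%:R^-1 * c%:R)).
    rewrite /g; case: (posnP (survivors n y)) => [->|c0] /=; first by rewrite mulr0 addr0.
    case: leqP => [_|kc]; first by rewrite lerDl mulr_ge0// invr_ge0 ltW.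
    by rewrite add0r mulrC ler_pdivlMr// mul1r ler_nat ltnW.
  rewrite (espD (D := D)); [|exact: (fs g)|exact: (fs (fun c => k%:R^-1 * c%:R))].
  rewrite (espZ (D := D))// esp_survivors esp_cst lerD2l -[leRHS]mulr1.
  by rewrite ler_wpM2l ?invr_ge0 ?(ltW k0')// exprn_ile1// ltW.
rewrite -(espZ (D := D)); last exact: (fs g).
apply: (@le_trans _ _ (esp (fun y => g (survivors n y) * (1 - p) ^+ (K * survivors n y)))).
  apply: (le_esp (D := D)) => [||y]; [exact: (fs (fun c => (1 - p) ^+ (K * k) * g c))| |].
    exact: (fs (fun c => g c * (1 - p) ^+ (K * c))).
  rewrite /g; case: andP => [[_ ck]|_]; last by rewrite mulr0 mul0r.
  rewrite mulr1 mul1r; apply: ler_wiXn2l => //.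
    by rewrite lerBlDr lerDl ltW.
  by rewrite leq_mul2l ck orbT.
rewrite -esp_extinct; [|exact: (fs g)|]; last first.
  by move=> u b y un; rewrite survivors_update// un.
rewrite lerBrDr /survival_prob -(espD (D := D)); last 2 first.
- by apply: findet_map2; [exact: (fs g)|exact: (fs (fun c => (c == 0)%:R))].
- exact: (fs (fun c => (0 < c)%N%:R)).
(* Extinction at level [n + 1] from at most [k] survivors and survival to level [n + 1] are
   disjoint, and both imply survival to level [n]. *)
apply: (le_esp (D := D)).
- apply: findet_map2; last exact: (fs (fun c => (0 < c)%N%:R)).
  by apply: findet_map2; [exact: (fs g)|exact: (fs (fun c => (c == 0)%:R))].
- exact: (fs (fun c => (0 < c)%N%:R)).
move=> y; case: (posnP (survivors n y)) => [c0|c0].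
  by rewrite /g c0 (survivors_eq0S c0)/= mul0r addr0.
rewrite /g c0; case: (posnP (survivors n.+1 y)) => _ /=.
  by rewrite mulr1 addr0 lern1 leq_b1.
by rewrite mulr0 add0r.
Qed.

End branching_process.

(** * Sequences with geometrically decreasing increments *)

Section geometric_increments.
Context {R : realType}.
Implicit Types (x : nat -> R) (r : R).

(* Cauchy-Schwarz for the weights [r ^+ k] and [r ^- k]. *)
Lemma sqr_telescope_le x r n : 0 < r -> (x n - x 0) ^+ 2 <=
  (\sum_(k < n) r ^+ k) * (\sum_(k < n) r ^- k * (x k.+1 - x k) ^+ 2).
Proof.
move=> r0; elim: n => [|n IH]; first by rewrite subrr expr0n !big_ord0 mulr0.
rewrite !big_ord_recr /=.
set A := \sum_(k < n) _ in IH *; set B := \sum_(k < n) _ in IH *.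
have A0 : 0 <= A by apply: sumr_ge0 => k _; rewrite exprn_ge0// ltW.
have B0 : 0 <= B.
  by apply: sumr_ge0 => k _; rewrite mulr_ge0 ?sqr_ge0// invr_ge0 exprn_ge0// ltW.
have u0 : 0 < r ^+ n by rewrite exprn_gt0.
set u := r ^+ n in u0 *; pose t := (x n.+1 - x n) / u.
have tE : x n.+1 - x n = t * u by rewrite /t divfK// gt_eqF.
have -> : x n.+1 - x 0 = (x n - x 0) + t * u by rewrite -tE; ring.
rewrite tE; set S := x n - x 0 in IH *.
(* AM-GM, multiplied by [A] *)
have key : 2 * S * t <= A * t ^+ 2 + B.
  move: A0; rewrite le_eqVlt => /predU1P[A0|A0].
    move: IH; rewrite -A0 !mul0r add0r => S0.
    have /eqP -> : S == 0 by rewrite -sqrf_eq0 eq_le S0 sqr_ge0.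
    by rewrite mulr0 mul0r.
  rewrite -subr_ge0 -(pmulr_rge0 _ A0).
  have -> : A * (A * t ^+ 2 + B - 2 * S * t) = (A * t - S) ^+ 2 + (A * B - S ^+ 2) by ring.
  by rewrite addr_ge0 ?sqr_ge0// subr_ge0.
have -> : u^-1 * (t * u) ^+ 2 = t ^+ 2 * u by field; rewrite gt_eqF.
rewrite -subr_ge0.
have -> : (A + u) * (B + t ^+ 2 * u) - (S + t * u) ^+ 2 =
    (A * B - S ^+ 2) + u * (A * t ^+ 2 + B - 2 * S * t) by ring.
by rewrite addr_ge0 ?subr_ge0// mulr_ge0 ?subr_ge0// ltW.
Qed.

Lemma sum_exp_le r n : 0 < r < 1 -> \sum_(k < n) r ^+ k <= (1 - r)^-1.
Proof.
move=> /andP[r0 r1].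
have /(_ n 1 r) := @geometric_le_lim R.
rewrite mul1r /series/= big_mkord => /(_ ler01 r0); rewrite gtr0_norm// => /(_ r1).
by apply: le_trans; apply: ler_sum => k _; rewrite mul1r.
Qed.

(** An increment of size [z] is at most [r^k], or else at most [r^-k z^2]; the sum of both bounds is
    summable, so the increments converge absolutely. *)
Lemma cvgn_weighted_increments x r : 0 < r < 1 ->
  (\sum_(0 <= k <oo) (r ^- k * (x k.+1 - x k) ^+ 2)%:E < +oo)%E -> cvgn x.
Proof.
move=> /andP[r0 r1] Sfin.
pose v k := r ^- k * (x k.+1 - x k) ^+ 2.
have v0 k : 0 <= v k by rewrite mulr_ge0 ?sqr_ge0// invr_ge0 exprn_ge0// ltW.
have cv : cvgn (series v).
  apply: nondecreasing_is_cvgn.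
    by apply: nondecreasing_series => k _ _; exact: v0.
  exists (fine (\sum_(0 <= k <oo) (v k)%:E)%E) => _ [n _ <-].
  rewrite -lee_fin fineK; last first.
    by rewrite ge0_fin_numE// nneseries_ge0// => k _ _; rewrite lee_fin.
  rewrite /series/= -sumEFin.
  by apply: nneseries_lim_ge => k _ _; rewrite lee_fin.
have cg : cvgn (series (geometric 1 r)).
  by apply: is_cvg_geometric_series; rewrite gtr0_norm.
have cx : cvgn (series (fun k => x k.+1 - x k)).
  apply: normed_cvg; apply: (@series_le_cvg R _ (fun k => geometric 1 r k + v k)) => [k|k|k|].
  - exact: normr_ge0.
  - by rewrite /= mul1r addr_ge0// exprn_ge0// ltW.
  - rewrite /= mul1r /v; have a0 : 0 < r ^+ k by rewrite exprn_gt0.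
    set a := r ^+ k in a0 *; rewrite -real_normK ?num_real//.
    have := normr_ge0 (x k.+1 - x k); set z := `|_| => z0.
    have [za|az] := leP z a.
      by rewrite (le_trans za)// lerDl mulr_ge0 ?sqr_ge0// invr_ge0 ltW.
    rewrite (@le_trans _ _ (a^-1 * z ^+ 2))//; last by rewrite lerDr ltW.
    by rewrite mulrC ler_pdivlMr// expr2 ler_wpM2l// ltW.
  - exact: is_cvg_seriesD.
rewrite (_ : x = fun n => x 0 + series (fun k => x k.+1 - x k) n); last first.
  by apply/funext => n; rewrite /series/= telescope_sumr// addrC subrK.
by apply: is_cvgD => //; exact: is_cvg_cst.
Qed.

End geometric_increments.

(** [limn] is the upper limit where the lower and upper limits agree and are finite, and the default
    [point] elsewhere; both pieces and the set dividing them are measurable. *)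
Lemma measurable_fun_limn (d : measure_display) (T : measurableType d) (R : realType)
    (X : nat -> T -> R) : (forall n, measurable_fun setT (X n)) ->
  measurable_fun setT (fun w => limn (X ^~ w)).
Proof.
move=> mX.
pose v n : T -> \bar R := EFin \o X n.
have mv n : measurable_fun setT (v n) by exact/measurable_EFinP.
pose u w := v ^~ w.
pose g w := limn_esup (u w); pose h w := limn_einf (u w).
have mg : measurable_fun setT g by exact: (measurable_fun_limn_esup (f := v)).
have mh : measurable_fun setT h.
  apply: measurableT_comp => //.
  apply: (measurable_fun_limn_esup (f := fun n w => - v n w)%E) => n.
  exact: measurableT_comp.
pose b w := (h w == g w) && (g w \is a fin_num).
have bP w : b w -> X ^~ w @ \oo --> fine (g w).
  move=> /andP[/eqP hg gfin].
  suff : u w n @[n --> \oo] --> (fine (g w))%:E by exact: fine_cvg.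
  rewrite fineK//.
  apply: (@squeeze_cvge _ _ _ _ (einfs (u w)) _ (esups (u w))).
  - apply: nearW => n; apply/andP; split.
      by apply: ereal_inf_lbound; exists n => /=.
    by apply: ereal_sup_ubound; exists n => /=.
  - by rewrite -hg /h limn_einf_lim; exact: is_cvg_einfs.
  - by rewrite /g limn_esup_lim; exact: is_cvg_esups.
rewrite (_ : (fun w => _) = fun w => if b w then fine (g w) else point).
  apply: measurable_fun_ifT.
  - apply: measurable_and; first exact: measurable_fun_eqe.
    by apply: (measurable_fun_bool true); exact: emeasurable_fin_num.
  - exact: measurableT_comp.
  - exact: measurable_cst.
apply/funext => w; case: ifPn => [/bP/cvg_lim->//|nb].
apply: dvgP => /cvg_ex[l Xl]; move/negP: nb; apply.
have : u w n @[n --> \oo] --> l%:E by apply: cvg_EFin => //; exact: nearW.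
by move=> /cvg_limn_einf_sup[]; rewrite /b /g /h => -> ->; rewrite eqxx.
Qed.

(** * Convergence of means and variances by domination *)

Section l2_convergence.
Context {d : measure_display} {T : measurableType d} {R : realType}
  {P : probability T R} (X : nat -> T -> R) (B r : R).
Hypothesis mX : forall n, measurable_fun setT (X n).
Hypothesis X0 : forall w, X 0 w = 1.
Hypothesis r01 : 0 < r < 1.
Hypothesis B0 : 0 <= B.
Hypothesis incrX : forall n,
  (\int[P]_w ((X n.+1 w - X n w) ^+ 2)%:E)%E = (B * (r ^+ n) ^+ 2)%:E.

Let S w := (\sum_(0 <= k <oo) (r ^- k * (X k.+1 w - X k w) ^+ 2)%:E)%E.

Let r0 : 0 < r. Proof. by case/andP: r01. Qed.

Let term_ge0 k w : (0 <= (r ^- k * (X k.+1 w - X k w) ^+ 2)%:E)%E.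
Proof. by rewrite lee_fin mulr_ge0 ?sqr_ge0// invr_ge0 exprn_ge0// ltW. Qed.

Let mincr k : measurable_fun setT (fun w => (X k.+1 w - X k w) ^+ 2).
Proof. by apply: measurable_funX; exact: measurable_funB. Qed.

Let mterm k : measurable_fun setT (fun w => (r ^- k * (X k.+1 w - X k w) ^+ 2)%:E).
Proof. by apply/measurable_EFinP; apply: measurable_funM. Qed.

Let S_ge0 w : (0 <= S w)%E.
Proof. by apply: nneseries_ge0 => k _ _; exact: term_ge0. Qed.

(** The weight [r ^- k] costs one of the two factors [r ^+ k] in [incrX], which leaves a geometric
    series bounded by [B / (1 - r)]. *)
Let integrable_S : P.-integrable setT S.
Proof.
apply/integrableP; split.
  by apply: ge0_emeasurable_sum => // k w _ _; exact: term_ge0.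
under eq_integral => w _ do rewrite gee0_abs//.
rewrite integral_nneseries//.
apply: (@le_lt_trans _ _ (B * (1 - r)^-1)%:E); last exact: ltry.
have E k : (\int[P]_w (r ^- k * (X k.+1 w - X k w) ^+ 2)%:E)%E = (B * r ^+ k)%:E.
  under eq_integral do rewrite EFinM.
  rewrite ge0_integralZl_EFin//.
  - rewrite incrX -EFinM; congr EFin.
    by field; rewrite gt_eqF// exprn_gt0.
  - by move=> w _; rewrite lee_fin sqr_ge0.
  - exact/measurable_EFinP.
  - by rewrite invr_ge0 exprn_ge0// ltW.
apply: lime_le.
  by apply: is_cvg_nneseries => k _ _; rewrite E lee_fin mulr_ge0 ?exprn_ge0// ltW.
apply: nearW => n; under eq_bigr do rewrite E.
rewrite sumEFin lee_fin -mulr_sumr big_mkord.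
by apply: ler_wpM2l => //; exact: sum_exp_le.
Qed.

Let dominated n w : (((X n w - 1) ^+ 2)%:E <= (1 - r)^-1%:E * S w)%E.
Proof.
have := sqr_telescope_le (X ^~ w) n r0; rewrite /= X0 => h.
apply: (@le_trans _ _ ((1 - r)^-1%:E *
    (\sum_(k < n) r ^- k * (X k.+1 w - X k w) ^+ 2)%:E)%E).
  rewrite -EFinM lee_fin (le_trans h)// ler_wpM2r ?sum_exp_le//.
  by apply: sumr_ge0 => k _; have := term_ge0 k w; rewrite lee_fin.
apply: lee_wpmul2l.
  by rewrite lee_fin invr_ge0 subr_ge0; case/andP: r01 => _ /ltW.
rewrite -sumEFin -(big_mkord xpredT (fun k => (r ^- k * (X k.+1 w - X k w) ^+ 2)%:E)).
by apply: nneseries_lim_ge => k _ _; exact: term_ge0.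
Qed.

Lemma ae_cvgn : {ae P, forall w, X n w @[n --> \oo] --> limn (X ^~ w)}.
Proof.
apply: filterS (integrable_ae measurableT integrable_S) => w /(_ I) Sfin.
apply: (cvgn_weighted_increments r01).
by rewrite -ge0_fin_numE// S_ge0.
Qed.

(** One bound for both dominated convergences: the constant [2] serves [|x| <= 2 + (x - 1)^2]. *)
Let G w := (2%:E + (1 - r)^-1%:E * S w)%E.

Let integrable_G : P.-integrable setT G.
Proof.
apply: integrableD => //; last exact: integrableZl.
exact: finite_measure_integrable_cst.
Qed.

Let sqr_le_G n w : (((X n w - 1) ^+ 2)%:E <= G w)%E.
Proof. by rewrite (le_trans (dominated n w))// leeDr. Qed.

Let abs_le_G n w : (`|X n w|%:E <= G w)%E.
Proof.
apply: (@le_trans _ _ (2%:E + ((X n w - 1) ^+ 2)%:E)%E); last first.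
  by rewrite leeD2l// dominated.
rewrite -EFinD lee_fin; have := sqr_ge0 (`|X n w - 1| - 1).
have := real_normK (num_real (X n w - 1)); have := normr_ge0 (X n w - 1).
have : `|X n w| <= `|X n w - 1| + 1.
  by rewrite -[X in `|X| <= _](subrK 1) (le_trans (ler_normD _ _))// normr1.
move=> h1 h2 <-; nra.
Qed.

Let mlim := measurable_fun_limn mX.

Lemma cvg_integral_limn :
  (\int[P]_w (X n w)%:E)%E @[n --> \oo] --> (\int[P]_w (limn (X ^~ w))%:E)%E.
Proof.
have [||||_ _ //] := @dominated_convergence _ _ _ P setT measurableT
  (fun n w => (X n w)%:E) (fun w => (limn (X ^~ w))%:E) G _ _ _ integrable_G.
- by move=> n; exact/measurable_EFinP.
- exact/measurable_EFinP.
- by apply: filterS ae_cvgn => w h _; apply: cvg_EFin => //; exact: nearW.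
- by apply: aeW => w n _; exact: abs_le_G.
Qed.

Lemma cvg_integral_sqr_limn :
  (\int[P]_w ((X n w - 1) ^+ 2)%:E)%E @[n --> \oo] -->
  (\int[P]_w ((limn (X ^~ w) - 1) ^+ 2)%:E)%E.
Proof.
have [||||_ _ //] := @dominated_convergence _ _ _ P setT measurableT
  (fun n w => ((X n w - 1) ^+ 2)%:E) (fun w => ((limn (X ^~ w) - 1) ^+ 2)%:E) G _ _ _ integrable_G.
- by move=> n; apply/measurable_EFinP; apply: measurable_funX; exact: measurable_funB.
- by apply/measurable_EFinP; apply: measurable_funX; exact: measurable_funB.
- apply: filterS ae_cvgn => w h _; apply: cvg_EFin; first exact: nearW.
  have c1 : X n w - 1 @[n --> \oo] --> limn (X ^~ w) - 1.
    by apply: cvgB => //; exact: cvg_cst.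
  exact: (cvgM c1 c1).
- by apply: aeW => w n _; rewrite gee0_abs ?lee_fin ?sqr_ge0//; exact: sqr_le_G.
Qed.

End l2_convergence.

(* A limit [l > 0] would satisfy [l <= k^-1] for every [k], since the right-hand
   differences tend to [0]. *)
Lemma cvg0_slow_decrease (R : realType) (a : nat -> R) :
  (forall n, 0 <= a n) -> nonincreasing_seq a ->
  (forall k, (0 < k)%N -> exists2 e, 0 < e &
    forall n, e * (a n - k%:R^-1) <= a n - a n.+1) ->
  a @ \oo --> 0.
Proof.
move=> a0 adec ha.
have ca : cvgn a by apply: nonincreasing_is_cvgn => //; exists 0 => _ [n _ <-].
suff <- : limn a = 0 by [].
apply/eqP; rewrite eq_le limr_ge ?andbT//; last exact: nearW.
rewrite leNgt; apply/negP => l0.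
have [k k0 kl] : exists2 k, (0 < k)%N & k%:R^-1 < limn a.
  exists (Num.truncn (limn a)^-1).+1 => //.
  by rewrite invf_plt ?posrE ?ltr0n// truncnS_gt.
have [e e0 he] := ha _ k0.
have cS : a n.+1 @[n --> \oo] --> limn a by rewrite (cvg_shiftS a).
have c1 : e * (a n - k%:R^-1) @[n --> \oo] --> e * (limn a - k%:R^-1).
  by apply: cvgM; [exact: cvg_cst|apply: cvgB => //; exact: cvg_cst].
have c2 : a n - a n.+1 @[n --> \oo] --> limn a - limn a by exact: cvgB.
have : limn (fun n => e * (a n - k%:R^-1)) <= limn (fun n => a n - a n.+1).
  by apply: ler_lim; [exact: cvgP c1|exact: cvgP c2|exact: nearW].
rewrite (cvg_lim _ c1)// (cvg_lim _ c2)// subrr pmulr_rle0// subr_le0.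
by rewrite leNgt kl.
Qed.

(** * Limits *)

Section martingale_limits.
Context {I : finType} {disp : measure_display} {T : measurableType disp}
  {R : realType} {P : probability T R} (p : R).
Let D : set (seq I) := [set s | s != [::]].
Hypothesis p0 : 0 < p.
Hypothesis p1 : p <= 1.
Hypothesis I0 : (0 < #|I|)%N.
Variable Y : seq I -> {RV P >-> bool}.
Hypothesis YD : forall s, D s -> distribution P (Y s) =1 bernoulli_prob p.
Hypothesis Yind : mutually_independent P D Y.

Local Notation K := (#|I|).
Local Notation m := (#|I|%:R * p).

Let X n w : R := martingale p n (config Y w).

Let m0 : 0 < m. Proof. by rewrite mulr_gt0// ltr0n. Qed.

Let mX n : measurable_fun setT (X n).
Proof. exact: findet_measurable (findet_martingale p n). Qed.

Lemma expectation_martingale n : 'E_P[X n]%E = 1%E.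
Proof.
rewrite unlock (EFin_esp (D := D) Y (findet_martingale p n)).
by rewrite (esp_martingale p0 p1 I0 YD Yind).
Qed.

Let variance_mean1 (f : T -> R) : 'E_P[f]%E = 1%E ->
  ('V_P[f] = \int[P]_w ((f w - 1) ^+ 2)%:E)%E.
Proof.
by move=> Ef; rewrite /variance unlock Ef unlock; apply: eq_integral => w _; rewrite /= expr2.
Qed.

Lemma variance_martingale n :
  'V_P[X n]%E = ((1 - p) / m * \sum_(k < n) m ^- k)%:E.
Proof.
rewrite variance_mean1 ?expectation_martingale//.
rewrite (EFin_esp (D := D) Y (h := fun y => (martingale p n y - 1) ^+ 2)).
  by rewrite (esp_martingale_var p0 p1 I0 YD Yind).
exact: (findet_map (fun x => (x - 1) ^+ 2) (findet_martingale p n)).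
Qed.

(** * Mean offspring number above [1] *)

Section supercritical.
Hypothesis m1 : 1 < m.

(** Chosen so that [(r^n)^2 = m^-n], the decay rate of the squared increments. *)
Let r := Num.sqrt m^-1.

Let r01 : 0 < r < 1.
Proof.
rewrite sqrtr_gt0 invr_gt0 m0 /= -[ltRHS]sqrtr1 ltr_sqrt// invf_lt1//.
Qed.

Let X0 w : X 0 w = 1.
Proof. by rewrite /X /martingale /survivors /level /= expr0 divr1. Qed.

Let B0 : 0 <= (1 - p) / m.
Proof. by rewrite divr_ge0 ?subr_ge0// ltW. Qed.

Let incrX n : (\int[P]_w ((X n.+1 w - X n w) ^+ 2)%:E)%E =
  ((1 - p) / m * (r ^+ n) ^+ 2)%:E.
Proof.
rewrite (EFin_esp (D := D) Y
    (h := fun y => (martingale p n.+1 y - martingale p n y) ^+ 2)).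
  rewrite (esp_increment_sqr p0 p1 I0 YD Yind) exprAC sqr_sqrtr ?exprVn//.
  by rewrite invr_ge0 ltW.
apply: (findet_map (fun x => x ^+ 2)).
apply: (findet_map2 (fun x y => x - y)); exact: findet_martingale.
Qed.

Lemma ae_cvg_martingale : {ae P, forall w, X n w @[n --> \oo] --> limn (X ^~ w)}.
Proof. exact: ae_cvgn mX r01 B0 incrX. Qed.

Lemma expectation_lim_martingale : 'E_P[fun w => limn (X ^~ w)]%E = 1%E.
Proof.
have := cvg_integral_limn mX X0 r01 B0 incrX.
rewrite unlock => /cvg_lim <-//; apply: cvg_lim => //.
rewrite (_ : (fun n => _) = cst 1%E); first exact: cvg_cst.
by apply/funext => n; have := expectation_martingale n; rewrite unlock.
Qed.

Let variance_closed n : 'V_P[X n]%E = ((1 - p) / (m - 1) * (1 - m ^- n))%:E.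
Proof.
rewrite variance_martingale; congr EFin.
have m10 : m - 1 != 0 by rewrite subr_eq0 gt_eqF.
elim: n => [|n IH]; first by rewrite big_ord0 expr0 invr1 subrr !mulr0.
rewrite big_ord_recr /= mulrDr IH exprS; field.
by rewrite m10 expf_neq0 ?gt_eqF//= ltr0n I0.
Qed.

Let cvg_expVn : m ^- n @[n --> \oo] --> (0 : R).
Proof.
have := @cvg_geometric R 1 m^-1; rewrite gtr0_norm ?invr_gt0// => /(_ _).
rewrite invf_lt1// => /(_ m1).
by rewrite (_ : geometric _ _ = fun n => m ^- n)//; apply/funext => n /=; rewrite mul1r exprVn.
Qed.

Lemma variance_lim_martingale :
  'V_P[fun w => limn (X ^~ w)]%E = ((1 - p) / (m - 1))%:E.
Proof.
rewrite variance_mean1 ?expectation_lim_martingale//.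
have /cvg_lim <-// := cvg_integral_sqr_limn mX X0 r01 B0 incrX.
apply: cvg_lim => //.
rewrite (_ : (fun n => _) = fun n => ((1 - p) / (m - 1) * (1 - m ^- n))%:E); last first.
  by apply/funext => n; rewrite -variance_closed variance_mean1// expectation_martingale.
apply: cvg_EFin; first exact: nearW.
have c1 : 1 - m ^- n @[n --> \oo] --> (1 - 0 : R) by apply: cvgB => //; exact: cvg_cst.
have c2 : (1 - p) / (m - 1) * (1 - m ^- n) @[n --> \oo] --> (1 - p) / (m - 1) * (1 - 0).
  by apply: cvgM => //; exact: cvg_cst.
by rewrite subr0 mulr1 in c2.
Qed.

Lemma variance_gap n : ('V_P[fun w => limn (X ^~ w)] - 'V_P[X n] =
  ((1 - p) / (m - 1) * m ^- n)%:E)%E.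
Proof.
by rewrite variance_lim_martingale variance_closed -EFinB; congr EFin; ring.
Qed.

Lemma cvg_variance_gap :
  ('V_P[fun w => limn (X ^~ w)] - 'V_P[X n] @[n --> \oo] --> 0)%E.
Proof.
under eq_cvg do rewrite variance_gap.
apply: cvg_EFin; first exact: nearW.
have c1 : (1 - p) / (m - 1) * m ^- n @[n --> \oo] --> (1 - p) / (m - 1) * 0.
  by apply: cvgM => //; exact: cvg_cst.
by rewrite mulr0 in c1.
Qed.

End supercritical.

(** * Mean offspring number at most [1] *)

Section subcritical.
Hypothesis m1 : m <= 1.
Hypothesis p_lt1 : p < 1.

(** The rate [(1 - p) ^+ (K * k)] does not depend on [n] and is positive because [p < 1]. *)
Let survival_prob_cvg0 : survival_prob Y n @[n --> \oo] --> 0.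
Proof.
have fs n : findet D (fun y => (0 < survivors n y)%N%:R : R).
  exact: (findet_map (fun c => (0 < c)%N%:R) (findet_survivors n)).
apply: cvg0_slow_decrease.
- by move=> n; apply: Rintegral_ge0 => w _.
- apply/nonincreasing_seqP => n; apply: (le_esp (D := D)) => // y.
  case: (posnP (survivors n y)) => [/survivors_eq0S ->//|_].
  by rewrite lern1 leq_b1.
- move=> k k0; exists ((1 - p) ^+ (K * k)); first by rewrite exprn_gt0// subr_gt0.
  by move=> n; exact: (survival_probS_le p0 p1 I0 YD Yind n k0 m1).
Qed.

(** Extinction is permanent, so the sequence is eventually zero off the event of survival at all
    levels. That event is null, being contained in each [A n]. *)
Lemma ae_cvg0_martingale : {ae P, forall w, X n w @[n --> \oo] --> (0 : R)}.
Proof.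
pose A n := [set w | (0 < survivors n (config Y w))%N].
have fs n : findet D (fun y => (0 < survivors n y)%N%:R : R).
  exact: (findet_map (fun c => (0 < c)%N%:R) (findet_survivors n)).
have indA n w : \1_(A n) w = (0 < survivors n (config Y w))%N%:R :> R.
  rewrite indicE; congr (nat_of_bool _)%:R.
  by apply/idP/idP => [/set_mem//|h]; exact: mem_set.
have mA n : measurable (A n).
  have := findet_measurable Y (fs n).
  move=> /(_ measurableT [set 1] (measurable_set1 _)).
  rewrite setTI; congr measurable; apply/seteqP; split => w; rewrite /A /=.
    by case: ltnP => //= _ /eqP; rewrite eq_sym oner_eq0.
  by move=> ->.
have PA n : P (A n) = (survival_prob Y n)%:E.
  rewrite /survival_prob -(EFin_esp (D := D))//.
  by under eq_integral do rewrite -indA; rewrite integral_indic// setIT.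
have mI : measurable (\bigcap_n A n) by exact: bigcapT_measurable.
exists (\bigcap_n A n); split => //.
  apply/eqP; rewrite eq_le measure_ge0 andbT -[leLHS]fineK ?fin_num_measure//.
  rewrite lee_fin; have <- := cvg_lim (@Rhausdorff R) survival_prob_cvg0.
  apply: limr_ge; first exact: cvgP survival_prob_cvg0.
  apply: nearW => n; rewrite -lee_fin fineK ?fin_num_measure// -PA.
  by apply: le_measure; rewrite ?inE// => w; exact.
move=> w /= Xw n _; rewrite /A /= lt0n; apply/negP => /eqP s0; apply: Xw.
apply: cvg_near_cst; exists n => // k /= nk; rewrite /X /martingale.
suff -> : survivors k (config Y w) = 0 by rewrite mul0r.
rewrite -(subnK nk); elim: (k - n)%N => // i IH.
by rewrite addSn; exact: survivors_eq0S.
Qed.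

(** For [m <= 1] every term [m ^- k] is at least [1], so the variance grows at least linearly. *)
Lemma cvg_variance_martingale_pinfty : ('V_P[X n] @[n --> \oo] --> +oo)%E.
Proof.
under eq_cvg do rewrite variance_martingale.
apply/cvgeryP.
have c0 : 0 < (1 - p) / m by rewrite divr_gt0// subr_gt0.
apply: (@ger_cvgy _ _ _ _ (fun n => (1 - p) / m * n%:R)).
  apply: nearW => n; rewrite ler_pM2l//.
  rewrite -[n in n%:R]card_ord -sumr_const; apply: ler_sum => k _.
  by rewrite invf_ge1 ?exprn_gt0// exprn_ile1// ltW.
apply/cvgryPge => A; have := nbhs_infty_ger (A / ((1 - p) / m)).
by apply: filterS => n; rewrite ler_pdivrMr// mulrC.
Qed.

End subcritical.

End martingale_limits.

(** * Identification of the percolation with the branching process *)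

Lemma percolation_stepE (R : realType) (d M : nat)
    (c : 'I_(M ^ d) -> {ffun 'I_d -> 'I_M})
    (disp : measure_display) (T : measurableType disp) (P : probability T R)
    (Y : seq 'I_(M ^ d) -> {RV P >-> bool}) n w :
  percolation_step c Y n w =
  \bigcup_(s in [set` seq.filter (alive^~ (config Y w)) (level n)]) cube c s.
Proof.
apply: eq_bigcupl; split => s /=.
  move=> [sn sY]; rewrite mem_filter mem_level sn eqxx andbT.
  by apply/aliveP => k; rewrite sn; exact: sY.
rewrite mem_filter mem_level => /andP[/aliveP sY /eqP sn]; split => // k kn.
by apply: sY; rewrite sn.
Qed.

(** From [M^D = M^d p] the scaling factor equals [p^-n], and the volume is [N_n / M^(d n)]. *)
Lemma rescaled_volumeE (R : realType) (d M : nat) (p : R)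
    (c : 'I_(M ^ d) -> {ffun 'I_d -> 'I_M})
    (disp : measure_display) (T : measurableType disp) (P : probability T R)
    (Y : seq 'I_(M ^ d) -> {RV P >-> bool}) n w :
  (1 < M)%N -> 0 < p -> bijective c ->
  rescaled_volume c Y p n w = martingale p n (config Y w).
Proof.
move=> M1 p0 c_bij; have M0 : (0 < M)%N by exact: ltnW.
have MR : 0 < M%:R :> R by rewrite ltr0n.
have Md0 : 0 < M%:R ^+ d :> R by rewrite exprn_gt0.
rewrite /rescaled_volume percolation_stepE volume_bigcup_cube//=.
rewrite /martingale /survivors card_ord natrX.
have lnM : ln (M%:R : R) != 0 by rewrite gt_eqF// ln_gt0// ltr1n.
have dimE : M%:R `^ percolation_dim d M p = M%:R ^+ d * p.
  rewrite /powR gt_eqF// /percolation_dim divfK// lnK// posrE mulr_gt0//.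
rewrite powRrM powR_mulrn ?powR_ge0// powRB; last first.
  by apply/implyP => _; rewrite gt_eqF.
rewrite powR_mulrn ?ltW// dimE.
have -> : M%:R ^+ d / (M%:R ^+ d * p) = p^-1 by field; rewrite !gt_eqF.
rewrite exprVn.
by rewrite exprMn invfM mulrC -mulrA.
Qed.

Theorem corollary3p1 (R : realType) (d M : nat) (p : R)
  (hd : (1 <= d)%N) (hM : (2 <= M)%N) (hp0 : 0 < p) (hp1 : p <= 1)
  (c : 'I_(M ^ d) -> {ffun 'I_d -> 'I_M}) (hc : bijective c)
  (disp : measure_display) (T : measurableType disp) (P : probability T R)
  (Y : seq 'I_(M ^ d) -> {RV P >-> bool}) (hY : iid_bernoulli p Y) :
  let Z := rescaled_volume c Y p in
  let Zoo := limit_volume c Y p in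
  (M%:R ^- d < p ->
     {ae P, forall w, Z n w @[n --> \oo] --> Zoo w} /\
     (forall n, 'E_P[Z n] = 1)%E /\
     ('E_P[Zoo] = 1)%E /\
     ('E_P[Z n] @[n --> \oo] --> 'E_P[Zoo])%E /\
     (forall n, 'V_P[Zoo] - 'V_P[Z n] =
        ((1 - p) / (M%:R ^+ d * p - 1) * (M%:R ^+ d * p) ^- n)%:E)%E /\
     ('V_P[Zoo] - 'V_P[Z n] @[n --> \oo] --> 0)%E) /\
  (p <= M%:R ^- d ->
     {ae P, forall w, Z n w @[n --> \oo] --> (0 : R)} /\
     {ae P, forall w, Zoo w = 0} /\
     (forall n, 'E_P[Z n] = 1)%E /\
     ('E_P[Z n] @[n --> \oo] --> 1)%E /\
     (1 != 'E_P[Zoo])%E /\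
     ('E_P[Zoo] = 0)%E /\
     ('V_P[Z n] @[n --> \oo] --> +oo)%E).
Proof.
move=> Z Zoo; have [YD Yind] := hY.
have ZE : Z = fun n w => martingale p n (config Y w).
  by apply/funext => n; apply/funext => w; exact: rescaled_volumeE.
have ZooE : Zoo = fun w => limn (fun n => martingale p n (config Y w)).
  by rewrite /Zoo /limit_volume -/Z ZE.
have Md0 : 0 < M%:R ^+ d :> R by rewrite exprn_gt0// ltr0n ltnW.
have mE : #|'I_(M ^ d)|%:R * p = M%:R ^+ d * p by rewrite card_ord natrX.
have I0 : (0 < #|'I_(M ^ d)|)%N by rewrite card_ord expn_gt0 (ltnW hM).
have EZ n : ('E_P[Z n] = 1)%E.
  by rewrite ZE; exact: (expectation_martingale hp0 hp1 I0 YD Yind n).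
have cvgEZ : ('E_P[Z n] @[n --> \oo] --> 1)%E.
  rewrite (_ : (fun n => _) = cst 1%E); first exact: cvg_cst.
  by apply/funext => n; exact: EZ.
split=> [hp|hp].
  have m1 : 1 < #|'I_(M ^ d)|%:R * p by rewrite mE mulrC -ltr_pdivrMr// mul1r.
  have EZoo : ('E_P[Zoo] = 1)%E.
    by rewrite ZooE; exact: (expectation_lim_martingale hp0 hp1 I0 YD Yind m1).
  split; first by rewrite ZE ZooE; exact: (ae_cvg_martingale hp0 hp1 I0 YD Yind m1).
  do 2 split => //.
  split; first by rewrite EZoo.
  rewrite ZE ZooE; split=> [n|].
    by rewrite (variance_gap hp0 hp1 I0 YD Yind m1) mE.
  exact: (cvg_variance_gap hp0 hp1 I0 YD Yind m1).
have m1 : #|'I_(M ^ d)|%:R * p <= 1 by rewrite mE mulrC -ler_pdivlMr// mul1r.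
(* [M^-d < 1] because [d >= 1] and [M >= 2]. *)
have p_lt1 : p < 1.
  rewrite (le_lt_trans hp)// invf_lt1//.
  by rewrite exprn_egt1// ?ltr1n// -lt0n.
have Z0 : {ae P, forall w, Z n w @[n --> \oo] --> (0 : R)}.
  by rewrite ZE; exact: (ae_cvg0_martingale hp0 hp1 I0 YD Yind m1 p_lt1).
have Zoo0 : {ae P, forall w, Zoo w = 0}.
  by apply: filterS Z0 => w; exact: cvg_lim.
have EZoo : ('E_P[Zoo] = 0)%E.
  (* [Zoo] vanishes only almost everywhere, so its measurability is needed to compare the
     integrals. *)
  rewrite unlock (ae_eq_integral (cst 0%E))//; first by rewrite integral0.
    apply/measurable_EFinP; rewrite ZooE; apply: measurable_fun_limn => n.
    exact: findet_measurable (findet_martingale p n).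
  by apply: filterS Zoo0 => w -> _.
do 4 split => //.
split; first by rewrite EZoo eqe oner_eq0.
split=> //.
by rewrite ZE; exact: (cvg_variance_martingale_pinfty hp0 hp1 I0 YD Yind m1 p_lt1).
Qed.
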